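(* Let $F=\mathbb{F}_q$ be the finite field with $q$ elements and $P\in\mathbb{F}_q[t]$ a polynomial of degree $d\ge1$. Let $\mu$ be the Haar measure on $\hat K$ normalized so that $\mu(\mathcal{M})=1$, restricted to $\mathcal{M}$, and consider the generalized Schneider map $T_P:\mathcal{M}\to\mathcal{M}$. Then $\mu$ is invariant under $T_P$, that is, $\mu(T_P^{-1}(X))=\mu(X)$ for every measurable set $X\subseteq\mathcal{M}$.
   Context: Notation: $\hat K=\mathbb{F}_q(\!(t^{-1})\!)$, with valuation $\nu$ satisfying $\nu(f/g)=\deg(g)-\deg(f)$ on $\mathbb{F}_q(t)$; $\mathcal{M}=\{z\in\hat K:\nu(z)>0\}=t^{-1}\mathbb{F}_q[[t^{-1}]]$; $A_d=\{Q\in\mathbb{F}_q[t]:\deg Q<d\}$. Generalized Schneider map: for $z\in\hat K^\times$ there is a unique pair $(f,n)\in A_d\times\mathbb{Z}$ such that $\nu\left(\frac{P^n}{z}-f\right)>0$ and $\nu(1/z)=nd-\deg(f)$. Define $T_P(z)=\frac{P^n}{z}-f\in\mathcal{M}$. At the single point $z=0$ (of measure zero) set $T_P(0)=0$. Thus $T_P$ restricts to a map $\mathcal{M}\to\mathcal{M}$. *)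

(* Defs.v *)
From HB Require Import structures.
From mathcomp Require Import all_boot all_order all_algebra.
From mathcomp Require Import zify.
From mathcomp Require Import all_classical all_reals all_analysis.

Set Implicit Arguments.
Unset Strict Implicit.
Unset Printing Implicit Defensive.

Import Order.TTheory GRing.Theory Num.Theory.
Local Open Scope classical_set_scope.
Local Open Scope ring_scope.

(* [lcoef x n] is the coefficient of t^(-n) in x, so that the support is
   bounded below and the valuation is the least index of the support. *)
Record laurent (F : fieldType) := Laurent {
  lcoef :> int -> F ;
  laurentP : `[< exists N : int, forall n, n < N -> lcoef n = 0 >] }.

HB.instance Definition _ (F : fieldType) := [isSub for @lcoef F].
HB.instance Definition _ (F : fieldType) := [Choice of laurent F by <:].

Section LaurentField.
Variable F : fieldType.
Implicit Types x y z : laurent F.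

Definition bounded_by (N : int) (a : int -> F) := forall n, n < N -> a n = 0.

Lemma laurent_bound x : exists N, bounded_by N x.
Proof. by have /asboolP := laurentP x. Qed.

Lemma laurent_ext x y : (forall n, x n = y n) -> x = y.
Proof. by move=> xy; apply: val_inj; apply/funext. Qed.

Lemma bounded_byW N N' a : N' <= N -> bounded_by N a -> bounded_by N' a.
Proof. by move=> NN' aN n nN'; apply: aN; exact: lt_le_trans NN'. Qed.

Fact lzero_subproof : `[< exists N, bounded_by N (fun=> 0) >].
Proof. by apply/asboolP; exists 0. Qed.
Definition lzero := Laurent lzero_subproof.

Fact lone_subproof : `[< exists N, bounded_by N (fun n => (n == 0)%:R) >].
Proof. by apply/asboolP; exists 0 => n; rewrite lt_neqAle => /andP[/negPf ->]. Qed.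
Definition lone := Laurent lone_subproof.

Fact lopp_subproof x : `[< exists N, bounded_by N (fun n => - x n) >].
Proof.
by have [N xN] := laurent_bound x; apply/asboolP; exists N => n /xN ->; rewrite oppr0.
Qed.
Definition lopp x := Laurent (lopp_subproof x).

Fact ladd_subproof x y : `[< exists N, bounded_by N (fun n => x n + y n) >].
Proof.
have [[N xN] [M yM]] := (laurent_bound x, laurent_bound y); apply/asboolP.
exists (Num.min N M) => n; rewrite lt_min => /andP[/xN -> /yM ->].
by rewrite addr0.
Qed.
Definition ladd x y := Laurent (ladd_subproof x y).

Fact laddA : associative ladd.
Proof. by move=> x y z; apply: laurent_ext => n /=; rewrite addrA. Qed.
Fact laddC : commutative ladd.
Proof. by move=> x y; apply: laurent_ext => n /=; rewrite addrC. Qed.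
Fact ladd0 : left_id lzero ladd.
Proof. by move=> x; apply: laurent_ext => n /=; rewrite add0r. Qed.
Fact laddN : left_inverse lzero lopp ladd.
Proof. by move=> x; apply: laurent_ext => n /=; rewrite addNr. Qed.

HB.instance Definition _ := GRing.isZmodule.Build (laurent F) laddA laddC ladd0 laddN.

(* The Cauchy product; the support of the summand is always finite. *)
Definition conv (a b : int -> F) (n : int) : F :=
  \sum_(i \in [set: int]) a i * b (n - i).

Lemma sum_window (f : int -> F) (N : int) m :
  (forall i, i < N -> f i = 0) -> (forall i, N + m%:Z <= i -> f i = 0) ->
  \sum_(i \in [set: int]) f i = \sum_(k < m) f (N + k%:Z).
Proof.
move=> f_lo f_hi; pose r := [seq N + k%:Z | k <- iota 0 m].
rewrite (fsbigE r) => //.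
- rewrite (eq_bigl xpredT); last by move=> i; exact: mem_set.
  by rewrite big_map -[in iota 0 m](subn0 m) big_mkord.
- by rewrite map_inj_uniq ?iota_uniq // => i j /addrI [].
move=> i _ ir; have [/f_lo //|Ni] := ltP i N; apply: f_hi.
rewrite leNgt; apply: contra ir => iNm; apply/mapP.
exists `|i - N|%N; last by rewrite gez0_abs ?subr_ge0 // subrKC.
by rewrite mem_iota add0n -ltz_nat gez0_abs ?subr_ge0 //= ltrBlDl.
Qed.

Lemma conv_bound N M a b :
  bounded_by N a -> bounded_by M b -> bounded_by (N + M) (conv a b).
Proof.
move=> aN bM n nNM; apply: fsbig1 => i _.
have [/aN ->|Ni] := ltP i N; first by rewrite mul0r.
by rewrite bM ?mulr0 // ltrBlDr (lt_le_trans nNM) // addrC lerD2l.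
Qed.

Definition window (N : int) m (a : int -> F) : {poly F} :=
  \poly_(k < m.+1) a (N + k%:Z).

Lemma coef_window N m a k : (k <= m)%N -> (window N m a)`_k = a (N + k%:Z).
Proof. by move=> km; rewrite coef_poly ltnS km. Qed.

Lemma convE N M m k a b : bounded_by N a -> bounded_by M b -> (k <= m)%N ->
  conv a b (N + M + k%:Z) = (window N m a * window M m b)`_k.
Proof.
move=> aN bM km; rewrite /conv (@sum_window _ N k.+1).
- rewrite coefM; apply: eq_bigr => -[i /= ik] _.
  rewrite !coef_window ?(leq_trans (leq_subr _ _)) ?(leq_trans _ km) //.
  by congr (_ * b _); lia.
- by move=> i /aN ->; rewrite mul0r.
by move=> i Ni; rewrite bM ?mulr0 //; lia.
Qed.

Lemma coefM_eq (p p' q q' : {poly F}) m :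
  (forall k, (k <= m)%N -> p`_k = p'`_k) -> (forall k, (k <= m)%N -> q`_k = q'`_k) ->
  (p * q)`_m = (p' * q')`_m.
Proof.
move=> pp' qq'; rewrite !coefM; apply: eq_bigr => -[i /= im] _.
by rewrite pp' // qq' // leq_subr.
Qed.

Lemma above_bound (N n : int) : N <= n -> exists m : nat, n = N + m%:Z.
Proof.
by move=> Nn; exists `|n - N|%N; rewrite gez0_abs ?subr_ge0 // subrKC.
Qed.

Fact lmul_subproof x y : `[< exists N, bounded_by N (conv x y) >].
Proof.
have [[N xN] [M yM]] := (laurent_bound x, laurent_bound y).
by apply/asboolP; exists (N + M); exact: conv_bound.
Qed.
Definition lmul x y := Laurent (lmul_subproof x y).

Fact lmulC : commutative lmul.
Proof.
move=> x y; apply: laurent_ext => n /=.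
have [[N xN] [M yM]] := (laurent_bound x, laurent_bound y).
have [nNM|/above_bound[m ->]] := ltP n (N + M).
  by rewrite (conv_bound xN yM) // (conv_bound yM xN) // addrC.
by rewrite (convE xN yM (leqnn m)) [N + M]addrC (convE yM xN (leqnn m)) mulrC.
Qed.

Fact lmulA : associative lmul.
Proof.
move=> x y z; apply: laurent_ext => n /=.
have [[N xN] [M yM]] := (laurent_bound x, laurent_bound y).
have [L zL] := laurent_bound z.
have [xyNM yzML] := (conv_bound xN yM, conv_bound yM zL).
have [nNML|/above_bound[m ->]] := ltP n (N + M + L).
  by rewrite (conv_bound xyNM zL) // (conv_bound xN yzML) // addrA.
rewrite (convE xyNM zL (leqnn m)) -[N + M + L]addrA (convE xN yzML (leqnn m)).
rewrite (@coefM_eq _ (window N m x) _ (window M m y * window L m z)) //; last first.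
  by move=> k km; rewrite coef_window // (convE yM zL km).
rewrite mulrA; apply: coefM_eq => // k km.
by rewrite coef_window // (convE xN yM km).
Qed.

Fact lmul1 : left_id lone lmul.
Proof.
move=> x; apply: laurent_ext => n /=; rewrite /conv (@sum_window _ 0 1).
- by rewrite big_ord1 addr0 eqxx mul1r subr0.
- by move=> i; rewrite /lone /= lt_neqAle => /andP[/negPf ->]; rewrite mul0r.
by move=> i; rewrite /lone /=; case: eqVneq => [->|_] //; rewrite mul0r.
Qed.

Fact lmulDl : left_distributive lmul ladd.
Proof.
move=> x y z; apply: laurent_ext => n /=.
have [[N0 xN] [M0 yM]] := (laurent_bound x, laurent_bound y).
have [L zL] := laurent_bound z.
pose N := Num.min N0 M0.
have {}xN : bounded_by N x by apply: bounded_byW xN; rewrite ge_min lexx.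
have {}yM : bounded_by N y by apply: bounded_byW yM; rewrite ge_min lexx orbT.
have xyN : bounded_by N (ladd x y) by move=> k kN /=; rewrite xN // yM // addr0.
have [nNL|/above_bound[m ->]] := ltP n (N + L).
  by rewrite (conv_bound xyN zL) // (conv_bound xN zL) // (conv_bound yM zL) // addr0.
rewrite (convE xyN zL (leqnn m)) (convE xN zL (leqnn m)) (convE yM zL (leqnn m)).
rewrite -coefD -mulrDl; apply: coefM_eq => // k km.
by rewrite coefD !coef_window.
Qed.

Fact lone_neq0 : lone != 0.
Proof. by apply/eqP => /(congr1 (fun x : laurent F => x 0)) /= /eqP; rewrite oner_eq0. Qed.

HB.instance Definition _ := GRing.Zmodule_isComNzRing.Build (laurent F)
  lmulA lmulC lmul1 lmulDl lone_neq0.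

Definition lead_index x (n : int) := x n != 0 /\ bounded_by n x.

Lemma lead_index_ex x : x != 0 -> exists n, lead_index x n.
Proof.
move=> x0; have [N xN] := laurent_bound x.
have [n xn] : exists n, x n != 0.
  apply: contrapT => /forallNP x_0; move/eqP: x0; apply.
  by apply: laurent_ext => n; apply/eqP; apply: contra_notT (x_0 n).
have ex : exists k : nat, x (N + k%:Z) != 0.
  have [/xN xn0|/above_bound[m nE]] := ltP n N; first by rewrite xn0 eqxx in xn.
  by exists m; rewrite -nE.
exists (N + (ex_minn ex)%:Z); case: ex_minnP => m xm mmin; split=> // k.
have [/xN //|/above_bound[j ->]] := ltP k N.
rewrite ltrD2l ltz_nat => jm; apply/eqP; apply: contraTT jm.
by rewrite -leqNgt; exact: mmin.
Qed.

Fixpoint inv_seq (A : nat -> F) (m : nat) : seq F :=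
  if m is m'.+1 then
    let s := inv_seq A m' in
    rcons s (((m' == 0%N)%:R - \sum_(k < m') s`_k * A (m' - k)%N) / A 0%N)
  else [::].

Lemma size_inv_seq A m : size (inv_seq A m) = m.
Proof. by elim: m => //= m IH; rewrite size_rcons IH. Qed.

Lemma nth_inv_seq A m k : (k < m)%N -> (inv_seq A m)`_k = (inv_seq A k.+1)`_k.
Proof.
elim: m => // m IH; rewrite ltnS leq_eqVlt => /predU1P[-> //|km].
by rewrite [in LHS]/= nth_rcons size_inv_seq km IH.
Qed.

Lemma lmulV_ex x : x != 0 -> exists y, y * x = 1.
Proof.
move=> /lead_index_ex[N [xN0 xN]].
pose A k := x (N + k%:Z); pose B k := (inv_seq A k.+1)`_k.
have A0 : A 0%N != 0 by rewrite /A addr0.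
pose b (n : int) := if n < - N then 0 else B (absz (n + N)).
have bE (i : nat) : b (- N + i%:Z) = B i.
  by rewrite /b ifF; [congr B; lia|lia].
have bN : bounded_by (- N) b by move=> n nN; rewrite /b nN.
have bP : `[< exists N, bounded_by N b >] by apply/asboolP; exists (- N).
exists (Laurent bP); apply: laurent_ext => n /=.
have [n0|/above_bound[m ->]] := ltP n (- N + N).
  rewrite (conv_bound bN xN) //; move: n0; rewrite addNr lt_neqAle.
  by move=> /andP[/negPf ->].
rewrite (convE bN xN (leqnn m)) addNr add0r coefM.
rewrite (eq_bigr (fun k : 'I_m.+1 => B k * A (m - k)%N)); last first.
  by move=> [k /= km] _; rewrite !coef_window ?leq_subr // bE.
rewrite big_ord_recr /= subnn {2}/B /=.
rewrite nth_rcons size_inv_seq ltnn eqxx -mulrA mulVf ?mulr1 //.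
rewrite addrC -addrA [X in _ + X](_ : _ = 0) ?addr0 //.
apply/eqP; rewrite addrC subr_eq0; apply/eqP/eq_bigr => -[i /= im] _.
by rewrite (nth_inv_seq _ im).
Qed.

Definition linv x : laurent F := if x == 0 then 0 else xget 0 [set y | y * x = 1].

Fact lmulVf x : x != 0 -> linv x * x = 1.
Proof.
move=> x0; rewrite /linv (negPf x0).
by have [y yx] := lmulV_ex x0; exact: (@xgetPex _ 0 [set y | y * x = 1]) (ex_intro _ y yx).
Qed.

Fact linv0 : linv 0 = 0.
Proof. by rewrite /linv eqxx. Qed.

HB.instance Definition _ := GRing.ComNzRing_isField.Build (laurent F) lmulVf linv0.

Definition lval x : \bar int :=
  if x == 0 then +oo%E else (xget 0 (lead_index x))%:E.

Lemma lead_index_uniq x n m : lead_index x n -> lead_index x m -> n = m.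
Proof.
move=> [xn xlen] [xm xlem]; apply/eqP; rewrite eq_le !leNgt.
apply/andP; split; apply/negP; [move=> /xlen xm0|move=> /xlem xn0].
  by rewrite xm0 eqxx in xm.
by rewrite xn0 eqxx in xn.
Qed.

Lemma lvalE x n : lead_index x n -> lval x = n%:E.
Proof.
move=> xn; rewrite /lval ifN; last by apply: contraNneq xn.1 => ->.
by rewrite (xget_unique 0 xn) // => m xm; exact: lead_index_uniq xm xn.
Qed.

Lemma lead_indexM x y n m :
  lead_index x n -> lead_index y m -> lead_index (x * y) (n + m).
Proof.
move=> [xn xlen] [ym ylem]; split; last exact: conv_bound.
have := convE xlen ylem (leqnn 0); rewrite /= !addr0 => ->.
by rewrite coefM big_ord1 !coef_window // !addr0 mulf_neq0.
Qed.

Lemma lvalM x y : lval (x * y) = (lval x + lval y)%E.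
Proof.
have [->|/lead_index_ex[n xn]] := eqVneq x 0.
  rewrite mul0r {1 2}/lval eqxx; have [->|/lead_index_ex[m ym]] := eqVneq y 0.
    by rewrite /lval eqxx.
  by rewrite (lvalE ym).
have [->|/lead_index_ex[m ym]] := eqVneq y 0.
  by rewrite mulr0 (lvalE xn) /lval eqxx.
by rewrite (lvalE (lead_indexM xn ym)) (lvalE xn) (lvalE ym).
Qed.

Lemma lead_indexV x n : lead_index x n -> lead_index x^-1 (- n).
Proof.
move=> xn; have x0 : x != 0 by apply: contraNneq xn.1 => ->.
have /lead_index_ex[m xVm] : x^-1 != 0 by rewrite invr_eq0.
suff -> : - n = m by [].
apply/eqP; rewrite eq_sym -subr_eq0 opprK addrC; apply/eqP.
apply: (@lead_index_uniq 1); last by split=> [|k /lt_eqF k0]; rewrite /= ?oner_eq0 ?k0.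
by rewrite -(divff x0); exact: lead_indexM.
Qed.

Lemma lead_indexXz x n (k : int) : lead_index x n -> lead_index (x ^ k) (k * n).
Proof.
move=> xn; have XnP (i : nat) : lead_index (x ^+ i) (i%:Z * n).
  elim: i => [|i IH].
    by rewrite mul0r; split=> [|k' /lt_eqF k0]; rewrite /= ?oner_eq0 ?k0.
  by rewrite exprS intS mulrDl mul1r; exact: lead_indexM.
case: k => i; first exact: XnP.
by rewrite NegzE mulNr -exprnN; exact: lead_indexV.
Qed.

Lemma lval_gtP x (N : int) :
  (N%:E < lval x)%E <-> (forall n, n <= N -> x n = 0).
Proof.
have [->|/lead_index_ex[m xm]] := eqVneq x 0.
  by split=> // _; rewrite /lval eqxx ltry.
rewrite (lvalE xm) lte_fin; case: xm => xm xlem; split=> [Nm n nN|xN].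
  by apply: xlem; exact: le_lt_trans Nm.
by rewrite ltNge; apply: contra xm => /xN ->.
Qed.

Definition lpoly_coef (p : {poly F}) (n : int) : F := if n <= 0 then p`_(absz n) else 0.

Lemma lpoly_bound (p : {poly F}) m :
  (size p <= m.+1)%N -> bounded_by (- m%:Z) (lpoly_coef p).
Proof.
move=> pm n nm; rewrite /lpoly_coef; case: ifP => // _.
by apply: nth_default; apply: leq_trans pm _; lia.
Qed.

Fact lpoly_subproof (p : {poly F}) : `[< exists N, bounded_by N (lpoly_coef p) >].
Proof. by apply/asboolP; exists (- (size p)%:Z); exact: lpoly_bound. Qed.
Definition lpoly (p : {poly F}) : laurent F := Laurent (lpoly_subproof p).

Fact lpoly_additive : zmod_morphism lpoly.
Proof.
move=> p q; apply: laurent_ext => n /=; rewrite /lpoly_coef.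
by case: ifP; rewrite ?coefB ?subr0.
Qed.
HB.instance Definition _ :=
  GRing.isZmodMorphism.Build {poly F} (laurent F) lpoly lpoly_additive.

Fact lpoly_monoid : monoid_morphism lpoly.
Proof.
split=> [|p q]; apply: laurent_ext => n /=.
  rewrite /lpoly_coef coef1; case: ifP => n0; first by rewrite absz_eq0.
  by rewrite (_ : (n == 0) = false) //; lia.
rewrite {1}/lpoly_coef; case: ifP => n0; last first.
  apply/esym/fsbig1 => i _; rewrite /lpoly_coef.
  have [i0|] := leP i 0; last by rewrite mul0r.
  by rewrite (_ : n - i <= 0 = false) ?mulr0 //; lia.
rewrite /conv (@sum_window _ n (absz n).+1).
- rewrite mulrC coefM; apply: eq_bigr => -[k /= kn] _.
  rewrite /lpoly_coef !ifT; [|lia|lia].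
  by rewrite mulrC; congr (p`_ _ * q`_ _); lia.
- move=> i ni; rewrite {2}/lpoly_coef ifF ?mulr0 //; lia.
by move=> i ni; rewrite {1}/lpoly_coef ifF ?mul0r //; lia.
Qed.
HB.instance Definition _ :=
  GRing.isMonoidMorphism.Build {poly F} (laurent F) lpoly lpoly_monoid.

Definition pdeg (p : {poly F}) : \bar int :=
  if p == 0 then -oo%E else ((size p).-1%:Z)%:E.

Lemma lval_lpoly (p : {poly F}) : lval (lpoly p) = (- pdeg p)%E.
Proof.
rewrite /pdeg; case: eqVneq => [->|p0]; first by rewrite raddf0 /lval eqxx.
apply: lvalE; split; last by apply: lpoly_bound; rewrite leqSpred.
rewrite /= /lpoly_coef ifT; last lia.
by rewrite abszN absz_nat -lead_coefE lead_coef_eq0.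
Qed.

Lemma lval_fraction (f g : {poly F}) : f != 0 -> g != 0 ->
  lval (lpoly f / lpoly g) = (pdeg g - pdeg f)%E.
Proof.
move=> f0 g0; have lg0 : lpoly g != 0.
  apply: contraTneq isT => lg; have := lval_lpoly g.
  by rewrite lg /lval eqxx /pdeg (negPf g0).
have := lvalM (lpoly f / lpoly g) (lpoly g); rewrite divfK // !lval_lpoly.
rewrite /pdeg (negPf f0) (negPf g0).
case: (lval _) => //= r [] /eqP; rewrite -subr_eq opprK => /eqP <-.
by rewrite addrC.
Qed.

Definition lopen (U : set (laurent F)) :=
  forall x, U x -> exists N : int, forall y, (N%:E < lval (y - x)%R)%E -> U y.

Fact lopenT : lopen setT.
Proof. by move=> x _; exists 0. Qed.

Fact lopenI : setI_closed lopen.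
Proof.
move=> U V oU oV x [/oU[N NU] /oV[M MV]]; exists (Num.max N M) => y.
by rewrite EFin_max gt_max => /andP[/NU ? /MV ?].
Qed.

Fact lopen_bigcup (I : Type) (f : I -> set (laurent F)) :
  (forall i, lopen (f i)) -> lopen (\bigcup_i f i).
Proof.
move=> of_ x [i _ /of_[N Nf]]; exists N => y /Nf fy; by exists i.
Qed.

HB.instance Definition _ := isOpenTopological.Build (laurent F)
  lopenT lopenI lopen_bigcup.
HB.instance Definition _ := isPointed.Build (laurent F) 0.

Definition borel_laurent := g_sigma_algebraType (@open (laurent F)).

(* The regularity conditions usually required of a Haar measure are automatic
   here: for F finite, [laurent F] is locally compact and second countable. *)
Definition haar_measure (R : realType) (mu : {measure set borel_laurent -> \bar R}) :=
  [/\ exists2 A, measurable A & mu A != 0%E,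
      forall C : set (laurent F), compact C -> (mu C < +oo)%E
    & forall (x : laurent F) (A : set borel_laurent), measurable A ->
        mu [set (x + y : laurent F) | y in A] = mu A].

Definition maxideal : set (laurent F) := [set z | (0 < lval z)%E].

Definition schneider_digit (P : {poly F}) (z : laurent F) (f : {poly F}) (n : int) :=
  let d := (size P).-1 in
  [/\ (pdeg f < (d%:Z)%:E)%E,
      (0 < lval (lpoly P ^ n / z - lpoly f)%R)%E
    & lval (z^-1) = ((n * d%:Z)%:E - pdeg f)%E].

(* The pair (f, n) exists and is unique, so that the use of [xget] in
   [schneider] below is legitimate. *)
Lemma schneider_digit_ex (P : {poly F}) z : (1 < size P)%N -> z != 0 ->
  exists f n, schneider_digit P z f n.
Proof.
move=> P1 z0; rewrite /schneider_digit; set d := (size P).-1.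
have d0 : (0 < d)%N by rewrite /d; lia.
have P0 : P != 0 by rewrite -size_poly_gt0; lia.
have Pd : lead_index (lpoly P) (- d%:Z).
  split; last by apply: lpoly_bound; rewrite leqSpred.
  rewrite /= /lpoly_coef ifT; last lia.
  by rewrite abszN absz_nat -lead_coefE lead_coef_eq0.
have [v zv] := lead_index_ex z0.
have dZ : d%:Z != 0 by lia.
have [vE j_ge0] := (divz_eq v d%:Z, modz_ge0 v dZ).
have jd := ltz_pmod v (_ : 0 < d%:Z).
set j := absz (v %% d%:Z)%Z.
have jE : (v %% d%:Z)%Z = j%:Z by rewrite /j gez0_abs.
have {}jd : (j < d)%N by rewrite -ltz_nat -jE jd //; lia.
pose n := - (v %/ d%:Z)%Z.
pose w := lpoly P ^ n / z.
have wj : lead_index w (- j%:Z).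
  suff -> : - j%:Z = n * - d%:Z - v by exact: lead_indexM (lead_indexXz n Pd) (lead_indexV zv).
  by rewrite {1}vE jE /n mulrNN opprD addrA subrr add0r.
pose f := \poly_(k < j.+1) w (- k%:Z).
have fj : f`_j != 0 by rewrite coef_poly ltnSn; case: wj.
have f0 : f != 0 by apply: contraNneq fj => ->; rewrite coef0.
have fs : size f = j.+1.
  apply/eqP; rewrite eqn_leq size_poly ltnNge; apply: contra fj => /leq_sizeP fj.
  by rewrite fj.
exists f, n; rewrite /pdeg (negPf f0) fs /=; split; first by rewrite lte_fin ltz_nat.
  rewrite -/w; apply/lval_gtP => i i0 /=; rewrite /lpoly_coef i0 coef_poly.
  case: ifP => [ij|ij]; first by rewrite (_ : - _ = i) ?subrr //; lia.
  by rewrite subr0; case: wj => _; apply; lia.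
rewrite (lvalE (lead_indexV zv)); congr (_%:E).
by rewrite {1}vE jE /n; lia.
Qed.

Lemma schneider_digit_uniq (P : {poly F}) z f f' n n' : z != 0 ->
  schneider_digit P z f n -> schneider_digit P z f' n' -> f = f' /\ n = n'.
Proof.
move=> z0; rewrite /schneider_digit; set d := (size P).-1.
have /lead_index_ex[v zv] : z^-1 != 0 by rewrite invr_eq0.
rewrite (lvalE zv) => -[fd wf vf] [fd' wf' vf'].
have nn : n = n'.
  move: fd fd' vf vf'; rewrite /pdeg; case: ifP => // _; case: ifP => // _.
  rewrite !lte_fin => fd fd' [vf] [vf'].
  have {}vf : v = n * d%:Z - (size f).-1%:Z by [].
  have {}vf' : v = n' * d%:Z - (size f').-1%:Z by [].
  apply/eqP; rewrite eq_le; apply/andP; split; rewrite leNgt; apply/negP => lt_n;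
  clearbody d; clear -fd fd' vf vf' lt_n; nia.
split=> //; move: wf wf'; rewrite nn; set w := _ / z => wf wf'.
apply/polyP => i.
have /lval_gtP/(_ (- i%:Z)) := wf; have /lval_gtP/(_ (- i%:Z)) := wf'.
rewrite /= /lpoly_coef oppr_le0 lez_nat leq0n abszN absz_nat.
by move=> /(_ isT)/eqP; rewrite subr_eq0 => /eqP <- /(_ isT)/eqP; rewrite subr_eq0 => /eqP.
Qed.

Definition schneider (P : {poly F}) (z : laurent F) : laurent F :=
  if z == 0 then 0 else
  let fn := xget (0, 0) [set fn : {poly F} * int | schneider_digit P z fn.1 fn.2] in
  lpoly P ^ fn.2 / z - lpoly fn.1.

End LaurentField.

Arguments maxideal F : clear implicits.
Arguments borel_laurent F : clear implicits.

(* Main.v *)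
Require Import Defs.
From mathcomp Require Import all_boot all_order all_algebra.
From mathcomp Require Import zify ring.
From mathcomp Require Import all_classical all_reals all_analysis.

Set Implicit Arguments.
Unset Strict Implicit.
Unset Printing Implicit Defensive.

Import Order.TTheory GRing.Theory Num.Theory.
Local Open Scope classical_set_scope.
Local Open Scope ring_scope.

(* On the points with a given digit (f, n), the map T_P is a bijection onto M
   whose inverse y |-> P^n / (f + y) sends balls to balls and scales all radii by
   the same constant.  Translation invariance of mu therefore makes the mass of
   T_P^-1(ball) depend only on the radius of the ball, not on its center in M.
   As a ball in M is the disjoint union of q balls of the next smaller radius, a
   measure of total mass 1 on M with this property is determined on balls: the
   mass of {z : nu(z - x) > k} is q^-k.  Hence mu and its image under T_P agree on
   balls, which form a pi-system generating the Borel sets. *)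

(** * Balls of the valuation *)

Section Balls.
Variable F : fieldType.
Implicit Types (x y z : laurent F) (N M : int) (p : {poly F}).

Definition lball x N : set (laurent F) := [set z | (N%:E < lval (z - x)%R)%E].

Lemma lballP x N z : lball x N z <-> (forall n, n <= N -> z n = x n).
Proof.
split=> [/lval_gtP zx n /zx /= /eqP|zx]; first by rewrite subr_eq0 => /eqP.
by apply/lval_gtP => n /zx /= ->; rewrite subrr.
Qed.

Lemma lball_center x N : lball x N x.
Proof. exact/lballP. Qed.

Lemma maxidealE : maxideal F = lball 0 0.
Proof. by apply/seteqP; split=> z; rewrite /lball /maxideal /= subr0. Qed.

Lemma lball_eq x y N : lball x N y -> lball y N = lball x N.
Proof.
move=> /lballP yx; apply/seteqP; split=> z /lballP zxy; apply/lballP => n nN.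
  by rewrite zxy // yx.
by rewrite zxy // yx.
Qed.

Lemma lball_sub x N M : N <= M -> lball x M `<=` lball x N.
Proof.
by move=> NM z /lballP zx; apply/lballP => n nN; apply: zx; exact: le_trans NM.
Qed.

Lemma lball_maxideal x z (k : nat) : lball x k z -> maxideal F z -> maxideal F x.
Proof.
rewrite maxidealE => /(@lball_sub _ 0 k isT) /lball_eq zx /lball_eq z0.
by rewrite -z0 zx; exact: lball_center.
Qed.

Lemma maxideal_lball x (k : nat) : maxideal F x -> lball x k `<=` maxideal F.
Proof. by rewrite maxidealE => /lball_eq <-; exact: lball_sub. Qed.

(** A common point can serve as the center of both balls, and concentric balls are nested. *)
Lemma lballI x y N M : N <= M ->
  lball x N `&` lball y M = set0 \/ lball x N `&` lball y M = lball y M.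
Proof.
move=> NM; have [[z [xz yz]]|] := pselect (lball x N `&` lball y M !=set0).
  right; rewrite -(lball_eq xz) -(lball_eq yz).
  by apply: setIidr; exact: lball_sub.
by move=> /set0P/negP/negPn/eqP; left.
Qed.

Lemma lball_translate x N : lball x N = [set (x + y : laurent F) | y in lball 0 N].
Proof.
apply/seteqP; split=> [z xz|_ [y y0 <-]]; last first.
  by rewrite /lball /= addrC addKr; move: y0; rewrite /lball /= subr0.
by exists (z - x); rewrite ?subrKC // /lball /= subr0.
Qed.

Lemma lball_open x N : open (lball x N).
Proof.
move=> y /lball_eq <-; exists N => z //.
Qed.

Fact lfrac_subproof p N :
  `[< exists M, forall n, n < M -> lpoly_coef p (n - N) = 0 >].
Proof.
have [M pM] := laurent_bound (lpoly p).
by apply/asboolP; exists (M + N) => n nMN; apply: pM; rewrite ltrBlDr.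
Qed.
(* The Laurent series [t^(-N) p]. *)
Definition lfrac p N : laurent F := Laurent (lfrac_subproof p N).

(** Cutting [x] off after index [N] leaves a finite sum, and only the coefficients up to [N] matter.
    Over a finite field this leaves countably many balls. *)
Lemma lball_lfrac x N : exists p, lball x N = lball (lfrac p N) N.
Proof.
have [M xM] := laurent_bound x.
exists (\poly_(i < (absz (N - M)).+1) x (N - i%:Z)); apply: lball_eq.
apply/lballP => n nN /=; rewrite /lpoly_coef ifT; last by rewrite subr_le0.
rewrite coef_poly; case: ifP => nM; first by congr (x _); lia.
by apply: xM; lia.
Qed.

(** Natural radii suffice to generate the topology, and such balls either lie in M or miss it.
    [set0] and [setT] provide stability under intersection and a cover of the space. *)
Definition lballs : set (set (laurent F)) :=
  [set A | [\/ A = set0, A = setT | exists x (k : nat), A = lball x k] ].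

Lemma setI_lballs : setI_closed lballs.
Proof.
move=> A B [->|->|[x [k ->]]] [->|->|[y [l ->]]]; rewrite ?setI0 ?set0I ?setIT ?setTI;
  try by [apply: Or31|apply: Or32|apply: Or33; eauto].
wlog kl : x y k l / (k <= l)%N.
  move=> wl; have [/wl//|/ltnW/wl] := leqP k l; by rewrite setIC.
have [->|->] := @lballI x y _ _ (kl : (k%:Z <= l%:Z)); first exact: Or31.
by apply: Or33; eauto.
Qed.
End Balls.

(** * Generation of the Borel sets by balls *)

Section BorelBalls.
Variable F : finFieldType.

Lemma lball_measurable (x : laurent F) N : measurable (lball x N : set (borel_laurent F)).
Proof. by apply: sub_sigma_algebra; exact: lball_open. Qed.

Lemma borel_lballs :
  @measurable _ (borel_laurent F) = <<s (@lballs F) >>.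
Proof.
apply/seteqP; split; last first.
  apply: smallest_sub => [|A]; first exact: smallest_sigma_algebra.
  move=> [->|->|[x [k ->]]].
  - exact: measurable0.
  - exact: measurableT.
  - exact: lball_measurable.
apply: smallest_sub => [|U oU]; first exact: smallest_sigma_algebra.
(* There are countably many balls [B pm]; those not contained in [U] are replaced by the empty
   set. *)
pose B (pm : {poly F} * nat) := lball (lfrac pm.1 pm.2) pm.2.
pose V pm := if `[< B pm `<=` U >] then B pm else set0.
have -> : U = \bigcup_pm V pm.
  apply/seteqP; split=> [x Ux|x [pm _]]; last by rewrite /V; case: asboolP => // + Bx; apply.
  have [N NU] := oU x Ux.
  (* Passing from [N] to its absolute value makes the radius index natural and can only shrink the
     ball. *)
  have [p pE] := lball_lfrac x (absz N)%:Z.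
  have Bx : B (p, absz N) = lball x (absz N)%:Z by [].
  exists (p, absz N) => //; rewrite /V asboolT Bx; first exact: lball_center.
  by move=> z /(@lball_sub _ _ N) zx; apply: NU; apply: zx; lia.
apply: (@countable_bigcupT_measurable _ (g_sigma_algebraType (@lballs F))) => [|pm].
  exact: countableP.
apply: sub_sigma_algebra; rewrite /V; case: asboolP => _; last exact: Or31.
by apply: Or33; eexists; eexists.
Qed.
End BorelBalls.

(** * Splitting a ball, and the mass of balls *)

Section BallSplit.
Variable F : fieldType.

(** The pieces are sorted by the first free coefficient, at index N + 1; [a] is its difference from
    that of [x]. *)
Lemma lball_split (x : laurent F) N :
  lball x N = \bigcup_a lball (x + lfrac a%:P (N + 1)) (N + 1).
Proof.
apply/seteqP; split=> [z /lballP zx|z [a _ /lballP zx]].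
  exists (z (N + 1) - x (N + 1)) => //; apply/lballP => n nN /=.
  rewrite /lpoly_coef coefC absz_eq0 subr_eq0.
  case: (eqVneq n (N + 1)) => [->|nN1]; first by rewrite subrr lexx subrKC.
  by rewrite if_same addr0 zx //; lia.
apply/lballP => n nN; rewrite zx; last lia.
rewrite /= /lpoly_coef coefC absz_eq0 ifT; last lia.
by rewrite ifF ?addr0 //; lia.
Qed.

Lemma trivIset_lball_split (x : laurent F) N :
  trivIset setT (fun a => lball (x + lfrac a%:P (N + 1)) (N + 1)).
Proof.
move=> a b _ _ [z [/lballP za /lballP zb]].
have := za (N + 1) (lexx _); rewrite zb //= => /addrI.
by rewrite /lpoly_coef !coefC subrr.
Qed.
End BallSplit.

Lemma lball_mass (R : realType) (F : finFieldType)
    (m : {measure set (borel_laurent F) -> \bar R}) :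
  (forall x (k : nat), maxideal F x -> m (lball x k) = m (lball 0 k)) ->
  m (maxideal F) = 1%E ->
  forall x (k : nat), maxideal F x -> m (lball x k) = (#|F|%:R ^- k)%:E.
Proof.
move=> m_inv m1 x k /m_inv ->; elim: k => [|k IH].
  by rewrite expr0 invr1 -maxidealE.
have q0 : (#|F|%:R : R) != 0.
  by rewrite pnatr_eq0 -lt0n; apply/card_gt0P; exists 0.
(* The q pieces are centered at a t^(-k-1), which lies in M, so by hypothesis they all have the same
   mass. *)
have kE : m (lball 0 k) = (#|F|%:R%:E * m (lball 0%R k.+1))%E.
  rewrite lball_split measure_fin_bigcup //.
  - rewrite (fsbigE (index_enum F)) ?index_enum_uniq //; last first.
      by move=> i _; rewrite mem_index_enum.
    rewrite mule_natl; transitivity (m (lball 0 k.+1) *+ #|F|); last by [].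
    rewrite -sumr_const; apply: eq_big => [a|a _]; first exact: mem_set.
    have -> : k%:Z + 1 = k.+1%:Z by lia.
    apply: m_inv; rewrite maxidealE; apply/lballP => n n0 /=.
    by rewrite add0r /lpoly_coef coefC absz_eq0 ifT ?ifF //; lia.
  - exact: finite_finset.
  - exact: trivIset_lball_split.
  - by move=> a _; exact: lball_measurable.
by rewrite exprS invfM EFinM -IH kE muleA -EFinM mulVf // mul1e.
Qed.

(** * Branches of the Schneider map *)

Section Branches.
Variables (F : fieldType) (P : {poly F}).
Implicit Types (x y z : laurent F) (f : {poly F}) (n k : int).

Lemma lval_lball x z N v : lval x = v%:E -> v <= N -> lball x N z -> lval z = v%:E.
Proof.
move=> xv vN /lballP zx; have x0 : x != 0 by apply: contra_eqN xv => /eqP ->; rewrite /lval eqxx.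
have [w xw] := lead_index_ex x0; move: xv; rewrite (lvalE xw) => -[wv].
apply: lvalE; rewrite -wv in vN *; case: xw => xw xlew; split; first by rewrite zx.
by move=> n nw; rewrite zx ?xlew //; lia.
Qed.

Lemma lead_indexN x v : lead_index x v -> lead_index (- x) v.
Proof. by move=> [xv xlev]; split=> [|n /xlev /= ->]; rewrite /= ?oppr_eq0 // oppr0. Qed.

Lemma lead_index_lval x v : lval x = v%:E -> lead_index x v.
Proof.
have [->|/lead_index_ex[w xw]] := eqVneq x 0; first by rewrite /lval eqxx.
by rewrite (lvalE xw) => -[<-].
Qed.

(** With 1/0 = 0 and nu(0) = +oo, every pair (0, n) is a digit of 0; the condition [z != 0] keeps
    the branches disjoint. *)
Definition branch f n (A : set (laurent F)) : set (laurent F) :=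
  [set z | [/\ z != 0, schneider_digit P z f n & A (lpoly P ^ n / z - lpoly f)]].

Lemma schneiderE z f n : z != 0 -> schneider_digit P z f n ->
  schneider P z = lpoly P ^ n / z - lpoly f.
Proof.
move=> z0 zfn; rewrite /schneider (negPf z0).
rewrite (@xget_unique _ _ [set fn | schneider_digit P z fn.1 fn.2] (f, n)) //.
by move=> [f' n'] /= zfn'; have [-> ->] := schneider_digit_uniq z0 zfn zfn'.
Qed.

Lemma schneider_preimageD0 (A : set (laurent F)) : (1 < size P)%N ->
  schneider P @^-1` A `\` [set 0] = \bigcup_fn branch fn.1 fn.2 A.
Proof.
move=> P1; apply/seteqP; split=> [z [Az /eqP z0]|z [[f n] _ [z0 zfn Az]]].
  have [f [n zfn]] := schneider_digit_ex P1 z0.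
  by exists (f, n) => //; split=> //; rewrite -schneiderE.
by split; [rewrite /preimage /= (schneiderE z0 zfn)|exact/eqP].
Qed.

Lemma trivIset_branch A : trivIset setT (fun fn => branch fn.1 fn.2 A).
Proof.
move=> [f n] [f' n'] _ _ [z [[z0 zfn _] [_ zfn' _]]].
by have /= [-> ->] := schneider_digit_uniq z0 zfn zfn'.
Qed.

Lemma schneider_maxideal z : (1 < size P)%N -> maxideal F (schneider P z).
Proof.
move=> P1; have [->|z0] := eqVneq z 0.
  by rewrite /schneider eqxx /maxideal /= /lval eqxx.
have [f [n zfn]] := schneider_digit_ex P1 z0.
by rewrite (schneiderE z0 zfn); case: zfn.
Qed.

(** All points of a branch have the same valuation deg f - n d, whose sign decides. The digit f = 0
    would force nu(1/z) = +oo, so its branches are empty. *)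
Lemma branch_maxideal f n :
  (forall A, branch f n A `&` maxideal F = branch f n A) \/
  (forall A, branch f n A `&` maxideal F = set0).
Proof.
have [f0|f0] := eqVneq f 0.
  right=> A; apply/seteqP; split=> // z [[z0 [_ _ zv] _] _].
  move: zv; rewrite /pdeg f0 eqxx; have /lead_index_ex[v zv] := z0.
  by rewrite (lvalE (lead_indexV zv)).
pose v := (size f).-1%:Z - n * (size P).-1%:Z.
have vE A z : branch f n A z -> lval z = v%:E.
  move=> [z0 [_ _]]; rewrite /pdeg (negPf f0); have /lead_index_ex[w zw] := z0.
  rewrite (lvalE (lead_indexV zw)) (lvalE zw) => -[wv] _.
  by congr (_%:E); rewrite /v -opprB -[X in _ = - X]wv opprK.
have [v0|v0] := ltP 0 v; [left|right] => A.
  by apply/setIidl => z /vE zv; rewrite /maxideal /= zv lte_fin.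
apply/seteqP; split=> // z [/vE zv]; rewrite /maxideal /= zv lte_fin.
by rewrite ltNge v0.
Qed.

(* On the branch with digit [(f, n)], the map is [z |-> P^n / z - f], and
   [P^n / z - P^n / z' = P^n (z' - z) / (z z')], where [z] and [z'] have the
   valuation [v = deg f - n d]: distances are scaled by a constant. *)
Lemma branch_lball f n : (1 < size P)%N ->
  (forall A, branch f n A = set0) \/
  exists r : int, forall y (k : nat), maxideal F y ->
    branch f n (lball y k) = lball (lpoly P ^ n / (lpoly f + y)) (k%:Z + r).
Proof.
move=> P1; set d := (size P).-1; set j := (size f).-1.
have [f0|f0] := eqVneq f 0.
  left=> A; apply/seteqP; split=> // z [z0 [_ _ zv] _].
  move: zv; rewrite /pdeg f0 eqxx; have /lead_index_ex[v zv] := z0.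
  by rewrite (lvalE (lead_indexV zv)).
have [jd|dj] := ltnP j d; last first.
  left=> A; apply/seteqP; split=> // z [z0 [+ _ _] _].
  by rewrite /pdeg (negPf f0) -/j -/d lte_fin ltz_nat ltnNge dj.
(* Since nu(P^n) = -nd and nu(z) = nu(z') = v, the image of z lies at valuation nu(z - z') - (nd +
   2v) from y. *)
right; pose v := j%:Z - n * d%:Z; exists (n * d%:Z + v + v) => y k y0.
have P0 : P != 0 by rewrite -size_poly_gt0; lia.
have Pd : lead_index (lpoly P ^ n) (- (n * d%:Z)).
  rewrite -mulrN; apply: lead_indexXz; apply: lead_index_lval.
  by rewrite lval_lpoly /pdeg (negPf P0).
set w := lpoly f + y.
have fj : lval (lpoly f) = (- j%:Z)%:E by rewrite lval_lpoly /pdeg (negPf f0).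
(* Adding [y] in M changes only coefficients of positive index, so f + y keeps the valuation -j of
   f. *)
have wj : lead_index w (- j%:Z).
  apply: lead_index_lval; apply: (lval_lball fj (_ : - j%:Z <= 0)); first lia.
  by move: y0; rewrite /lball /maxideal /w /= addrC addKr.
have w0 : w != 0 by apply: contraNneq wj.1 => ->.
set z' := lpoly P ^ n / w.
have z'v : lead_index z' v.
  by have := lead_indexM Pd (lead_indexV wj); congr (lead_index _ _); rewrite /v; lia.
have z'0 : z' != 0 by apply: contraNneq z'v.1 => ->.
have Pn0 : lpoly P ^ n != 0 by apply: contraNneq Pd.1 => ->.
have dist z : lead_index z v ->
    lball y k (lpoly P ^ n / z - lpoly f) <-> lball z' (k%:Z + (n * d%:Z + v + v)) z.
  move=> zv; have z0 : z != 0 by apply: contraNneq zv.1 => ->.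
  have uE : lpoly P ^ n / z - lpoly f - y = lpoly P ^ n * (- (z - z') / z / z').
    rewrite -addrA -opprD -/w /z'; clearbody w; move: (lpoly P ^ n) Pn0 => Q Q0.
    by field; rewrite w0 Q0 z0.
  rewrite /lball /= uE; have [->|] := eqVneq z z'.
    by rewrite subrr oppr0 !mul0r mulr0 /lval eqxx; split=> _; exact: ltry.
  rewrite -subr_eq0 => /lead_index_ex[e ze].
  have ue := lead_indexM Pd (lead_indexM (lead_indexM (lead_indexN ze)
    (lead_indexV zv)) (lead_indexV z'v)).
  rewrite (lvalE ue) (lvalE ze) !lte_fin; split; lia.
apply/seteqP; split=> z.
  move=> [z0 [_ _ zv] yz]; apply/dist => //.
  move: zv; rewrite /pdeg (negPf f0) -/j -/d => /lead_index_lval/lead_indexV.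
  by rewrite invrK; congr (lead_index _ _); rewrite /v; lia.
(* As nd + v = j >= 0, the radius index is at least v, so the ball fixes the leading term of z'. *)
move=> zz'; have zv : lead_index z v.
  apply: lead_index_lval; apply: lval_lball (lvalE z'v) _ zz'; rewrite /v; lia.
have yz := (dist _ zv).2 zz'.
split=> //; first by apply: contraNneq zv.1 => ->.
split; first by rewrite /pdeg (negPf f0) lte_fin ltz_nat.
  (* M is also the ball of index 0 around [y], and so contains [lball y k]. *)
  change (maxideal F (lpoly P ^ n / z - lpoly f)).
  move: y0; rewrite maxidealE => /lball_eq <-.
  exact: lball_sub yz.
rewrite (lvalE (lead_indexV zv)) /pdeg (negPf f0); congr (_%:E); rewrite /v; lia.
Qed.
End Branches.

Lemma eq_measure_bigcup_countable d (T : measurableType d) (R : realType)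
    (I : countType) (mu : {measure set T -> \bar R}) (G H : I -> set T) :
  (forall i, measurable (G i)) -> trivIset setT G ->
  (forall i, measurable (H i)) -> trivIset setT H ->
  (forall i, mu (G i) = mu (H i)) -> mu (\bigcup_i G i) = mu (\bigcup_i H i).
Proof.
pose N (K : I -> set T) (n : nat) := if pickle_inv n is Some i then K i else set0.
have muN (K : I -> set T) : (forall i, measurable (K i)) -> trivIset setT K ->
    mu (\bigcup_i K i) = (\sum_(0 <= n <oo) mu (N K n))%E.
  move=> mK tK; have -> : \bigcup_i K i = \bigcup_n N K n.
    apply/seteqP; split=> x.
      by move=> [i _ Kx]; exists (pickle i) => //; rewrite /N pickleK_inv.
    by move=> [n _]; rewrite /N; case: pickle_inv => // i Kx; exists i.
  rewrite measure_bigcup.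
  - by apply: eq_eseriesl => n; rewrite in_setT.
  - by move=> n _; rewrite /N; case: pickle_inv.
  move=> n m _ _ [x []]; rewrite /N.
  have := @pickle_invK I n; have := @pickle_invK I m.
  case: pickle_inv => // j /= <-; case: pickle_inv => // i /= <- Ki Kj.
  by congr pickle; apply: tK => //; exists x.
move=> mG tG mH tH GH; rewrite !muN //; apply: eq_eseriesr => n _.
by rewrite /N; case: pickle_inv.
Qed.

(** * Measurability of the Schneider map *)

Section BorelSchneider.
Variables (F : finFieldType) (P : {poly F}).
Hypothesis P1 : (1 < size P)%N.
Local Notation B := (borel_laurent F).

Lemma maxideal_measurable : measurable (maxideal F : set B).
Proof. by rewrite maxidealE; exact: lball_measurable. Qed.

Lemma singleton0_bigcap : [set (0 : laurent F)] = \bigcap_(k : nat) lball 0 k.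
Proof.
apply/seteqP; split=> [_ -> k _|z z0]; first exact: lball_center.
by apply: laurent_ext => n; apply: (lballP _ _ _).1 (z0 (absz n) Logic.I) _ _; lia.
Qed.

Lemma singleton0_measurable : measurable ([set 0] : set B).
Proof.
rewrite singleton0_bigcap.
by apply: bigcapT_measurable => k; exact: lball_measurable.
Qed.

Lemma branch_measurable f n y (k : nat) : maxideal F y ->
  measurable (branch P f n (lball y k) : set B).
Proof.
move=> y0; have [->|[r rE]] := branch_lball f n P1; first exact: measurable0.
by rewrite rE //; exact: lball_measurable.
Qed.

(** It suffices to test the generating balls. Up to the point 0, the preimage of a ball centered in
    M is a countable union of branches, each a ball or empty. *)
Lemma schneider_measurable : measurable_fun setT (schneider P : B -> B).
Proof.
apply: (@measurability _ _ B B _ _ (@lballs F)); first exact: borel_lballs.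
move=> _ [A lA <-]; rewrite setTI.
case: lA => [->|->|[x [k ->]]].
- by rewrite preimage_set0; exact: measurable0.
- by rewrite preimage_setT; exact: measurableT.
(* A ball centered outside M misses M, which contains all values of T_P. *)
have [x0|x0] := pselect (maxideal F x); last first.
  rewrite (_ : _ @^-1` _ = set0); first exact: measurable0.
  apply/seteqP; split=> // z /lball_maxideal Tx; apply: x0; apply: Tx.
  exact: schneider_maxideal.
rewrite -(setUIDK (schneider P @^-1` lball x k) [set 0]); apply: measurableU.
  by have [->|->] := subset_set1 (@subIsetr _ (schneider P @^-1` lball x k) [set 0]);
    [exact: measurable0|exact: singleton0_measurable].
rewrite schneider_preimageD0 //; apply: countable_bigcupT_measurable => [|fn].
  exact: countableP.
exact: branch_measurable.
Qed.

(** * Invariance of the Haar measure *)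

Section Haar.
Variables (R : realType) (mu : {measure set B -> \bar R}).
Hypotheses (haar_mu : haar_measure mu) (mu1 : mu (maxideal F) = 1%E).

Lemma haar_lball (x : laurent F) N : mu (lball x N) = mu (lball 0 N).
Proof.
by case: haar_mu => _ _ muT; rewrite lball_translate muT //; exact: lball_measurable.
Qed.

(** The point lies in balls of mass q^-k for every k. *)
Lemma haar_singleton0 : mu [set 0] = 0%E.
Proof.
apply/eqP; rewrite eq_le measure_ge0 andbT leNgt; apply/negP => mu0.
have mu0_le k : (mu [set (0%R : laurent F)] <= (#|F|%:R ^- k)%:E)%E.
  rewrite -(@lball_mass _ _ mu _ mu1 0 k); last 2 first.
  - by move=> x l _; exact: haar_lball.
  - by rewrite maxidealE; exact: lball_center.
  apply: le_measure; rewrite ?inE.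
  - exact: singleton0_measurable.
  - exact: lball_measurable.
  - by move=> _ ->; exact: lball_center.
case: (mu [set 0]) mu0 mu0_le => [r||] //; last by move=> _ /(_ 0%N).
(* This [k] satisfies 1/r < 2^k <= q^k, whence q^-k < r. *)
rewrite lte_fin => r0 /(_ (Num.Def.archi_bound r^-1)); rewrite lee_fin leNgt.
have q1 : (1 < #|F|)%N := card_finNzRing_gt1 F.
set k := Num.Def.archi_bound _; move/negP; apply.
have qk : r^-1 < #|F|%:R ^+ k.
  apply: lt_le_trans (upper_nthrootP (leqnn k)) _.
  by rewrite lerXn2r ?nnegrE ?ler0n // ler_nat.
by rewrite -[r]invrK ltf_pV2 // posrE ?invr_gt0 // (lt_trans _ qk) // invr_gt0.
Qed.

Lemma haar_setD0 (A : set B) : measurable A -> mu (A `\` [set 0]) = mu A.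
Proof.
move=> mA; have m0 := singleton0_measurable.
rewrite [RHS](measureDI mu mA m0) -[LHS]adde0; congr (_ + _)%E; apply/esym.
apply: (subset_measure0 (measurableI A [set (0 : laurent F)] mA m0) m0); first exact: subIsetr.
exact: haar_singleton0.
Qed.

(** Both branches are balls of the same radius, with centers depending on [y], so translation
    invariance applies. *)
Lemma haar_branch f n y (k : nat) : maxideal F y ->
  mu (branch P f n (lball y k) `&` maxideal F) =
  mu (branch P f n (lball 0 k) `&` maxideal F).
Proof.
move=> y0; case: (branch_maxideal P f n) => bM; rewrite !bM //.
have [bE|[r rE]] := branch_lball f n P1; first by rewrite !bE.
rewrite !rE //; first by rewrite haar_lball [RHS]haar_lball.
by rewrite maxidealE; exact: lball_center.
Qed.

Lemma haar_schneider_lball y (k : nat) : maxideal F y ->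
  mu (schneider P @^-1` lball y k `&` maxideal F) =
  mu (schneider P @^-1` lball 0 k `&` maxideal F).
Proof.
have max0 : maxideal F 0 by rewrite maxidealE; exact: lball_center.
move=> y0; have mpre x : measurable (schneider P @^-1` lball x k `&` maxideal F : set B).
  apply: measurableI; last exact: maxideal_measurable.
  rewrite -[X in measurable X]setTI; apply: schneider_measurable => //.
  exact: lball_measurable.
(* Removing the null point 0, where T_P is set by convention, leaves exactly the branches. *)
rewrite -(haar_setD0 (mpre y)) -(haar_setD0 (mpre 0)) -!setIDA -!setIDAC.
rewrite !schneider_preimageD0 // !setI_bigcupl.
have mbr x (fn : {poly F} * int) : maxideal F x ->
    measurable (branch P fn.1 fn.2 (lball x k) `&` maxideal F : set B).
  by move=> x0; apply: measurableI; [exact: branch_measurable|exact: maxideal_measurable].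
have tbr x : trivIset setT (fun fn : {poly F} * int =>
    branch P fn.1 fn.2 (lball x k) `&` maxideal F).
  by apply: trivIset_setIr; exact: trivIset_branch.
apply: eq_measure_bigcup_countable => // fn; [exact: mbr|exact: mbr|exact: haar_branch].
Qed.

(** Uniqueness of measures on a generating pi-system; since the total mass is finite, the constant
    sequence [setT] is an admissible exhaustion. *)
Lemma eq_measure_lballs (m1 m2 : {measure set B -> \bar R}) :
  m1 setT = m2 setT -> (m1 setT < +oo)%E ->
  (forall x (k : nat), m1 (lball x k) = m2 (lball x k)) ->
  forall A, measurable A -> m1 A = m2 A.
Proof.
move=> mT mTfin mB A; apply: (@measure_unique _ R B (@lballs F) (fun=> setT)) => //.
- exact: borel_lballs.
- exact: setI_lballs.
- by move=> _; exact: Or32.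
- by rewrite bigcup_const.
- by move=> _ [->|->|[x [k ->]]] //; rewrite !measure0.
Qed.

Lemma haar_schneider (A : set B) : measurable A ->
  mu (schneider P @^-1` A `&` maxideal F) = mu (A `&` maxideal F).
Proof.
have mM := maxideal_measurable.
(* [m2] is mu restricted to M and [m1] its image under T_P; both are to be compared on balls. *)
pose m2 : {measure set B -> \bar R} := mrestr mu mM.
(* The canonical measure structure on [pushforward] depends on a proof that the
   map is measurable, which [pose] leaves abstracted in [nu]. *)
pose nu : {measure set B -> \bar R} := pushforward m2 (schneider P : B -> B).
pose m1 := nu schneider_measurable.
have m1E X : m1 X = mu (schneider P @^-1` X `&` maxideal F) by [].
have m2E X : m2 X = mu (X `&` maxideal F) by [].
have m1M : m1 (maxideal F) = 1%E.
  rewrite m1E (_ : _ @^-1` _ = setT) ?setTI //; apply/seteqP; split=> // z _.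
  exact: schneider_maxideal.
have m2M : m2 (maxideal F) = 1%E by rewrite m2E setIid.
move=> mA; rewrite -m1E -m2E; apply: eq_measure_lballs mA.
- by rewrite m1E m2E preimage_setT.
- by rewrite m1E preimage_setT setTI mu1 ltry.
(* For a center in M both masses are q^-k; otherwise the ball misses M and both vanish. *)
move=> x k; have [x0|x0] := pselect (maxideal F x).
  rewrite (@lball_mass _ _ m1) ?(@lball_mass _ _ m2) // => y l y0.
    rewrite !m2E !setIidl; first exact: haar_lball.
    - by apply: maxideal_lball; rewrite maxidealE; exact: lball_center.
    - exact: maxideal_lball.
  exact: haar_schneider_lball.
have xM0 : lball x k `&` maxideal F = set0.
  by apply/seteqP; split=> // z [/lball_maxideal zx /zx].
rewrite m1E m2E xM0 (_ : _ @^-1` _ = set0) ?set0I //; apply/seteqP; split=> // z xTz.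
suff : (lball x k `&` maxideal F) (schneider P z) by rewrite xM0.
by split=> //; exact: schneider_maxideal.
Qed.
End Haar.
End BorelSchneider.

Theorem theorem4p3 (R : realType) (F : finFieldType) (d : nat) (P : {poly F})
    (mu : {measure set (borel_laurent F) -> \bar R}) :
  (1 <= d)%N -> pdeg P = (d%:Z)%:E ->
  haar_measure mu -> mu (maxideal F) = 1%E ->
  forall X : set (borel_laurent F), measurable X -> X `<=` maxideal F ->
    measurable (maxideal F `&` schneider P @^-1` X : set (borel_laurent F)) /\
    mu (maxideal F `&` schneider P @^-1` X) = mu X.
Proof.
move=> d1 Pd haar_mu mu1 X mX XM.
have P1 : (1 < size P)%N.
  move: Pd; rewrite /pdeg; case: ifP => // _ [Pd]; move: d1; rewrite -Pd.
  by case: (size P) => [|[]].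
split; last by rewrite setIC (haar_schneider P1) // setIidl.
apply: measurableI; first exact: maxideal_measurable.
by rewrite -[X in measurable X]setTI; apply: schneider_measurable.
Qed.
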